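(* Let $k:\Phi\to[0,\infty)$ be a nonnegative multiplicity parameter. The trigonometric Dunkl intertwining operator $\mathcal V_k$ is positivity preserving: if $f\in C^\infty(V)$ and $f(x)\ge0$ for all $x\in V$, then $\mathcal V_kf(x)\ge0$ for all $x\in V$.
   Context: $V\cong\mathbb R^n$ is a Euclidean space with inner product $\langle\cdot,\cdot\rangle$. $\Phi\subset V$ is an irreducible crystallographic root system spanning $V$ (not necessarily reduced), $\Phi^+$ a choice of positive roots, $W_0$ the Weyl group generated by the reflections $s_\alpha x=x-2\frac{\langle\alpha,x\rangle}{\langle\alpha,\alpha\rangle}\alpha$. A multiplicity parameter is a $W_0$-invariant function $k$ on $\Phi$. Set $\rho=\frac12\sum_{\alpha\in\Phi^+}k(\alpha)\alpha$. For $\xi\in V$ and $f\in C^1(V)$ the Dunkl–Cherednik operator is $$D_{k,\xi}f(x)=\partial_\xi f(x)+\sum_{\alpha\in\Phi^+}k(\alpha)\frac{\langle\alpha,\xi\rangle}{1-e^{-\langle\alpha,x\rangle}}\big[f(x)-f(s_\alpha x)\big]-\langle\rho,\xi\rangle f(x).$$ The trigonometric Dunkl intertwining operator $\mathcal V_k$ is the unique continuous linear operator on $C^\infty(V)$ (with its usual Fréchet topology) satisfying $D_{k,\xi}\circ\mathcal V_k=\mathcal V_k\circ\partial_\xi$ for all $\xi\in V$ and $\mathcal V_k(f)(0)=f(0)$ for all $f$; its existence and uniqueness are known (Trimèche). It satisfies $\mathcal V_k(e^{\langle s,\cdot\rangle})(x)=G_{k,s}(x)$ for all $s\in V_{\mathbb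 C}$, $x\in V$, where $\langle\cdot,\cdot\rangle$ is extended complex-bilinearly to the complexification $V_{\mathbb C}$, and $G_{k,s}\in C^\infty(V)$ (the Opdam–Cherednik kernel) is the unique function with $D_{k,\xi}G_{k,s}=\langle s,\xi\rangle G_{k,s}$ for all $\xi\in V$ and $G_{k,s}(0)=1$. *)

(* Defs.v *)
From HB Require Import structures.
From mathcomp Require Import all_boot all_order all_algebra.
From mathcomp Require Import finmap.
From mathcomp Require Import all_classical all_reals all_analysis.
From mathcomp Require Import complex.

Set Implicit Arguments.
Unset Strict Implicit.
Unset Printing Implicit Defensive.

Import Order.TTheory GRing.Theory Num.Theory numFieldNormedType.Exports.
Import ComplexField.

Local Open Scope classical_set_scope.
Local Open Scope complex_scope.
Local Open Scope ring_scope.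

Section RootSystems.
Context {R : realType} {n : nat}.
Local Notation V := 'rV[R]_n.
Implicit Types (Phi Pp : {fset V}) (a b h x y : V).

Definition dotv x y : R := \sum_(i < n) x 0 i * y 0 i.

Definition reflection a x : V := x - (2 * dotv a x / dotv a a) *: a.

Definition root_system Phi : Prop :=
  [/\ 0 \notin Phi,
      (<<enum_fset Phi>> = fullv)%VS,
      forall a b, a \in Phi -> b \in Phi -> reflection a b \in Phi &
      forall a b, a \in Phi -> b \in Phi ->
        2 * dotv a b / dotv a a \is a Num.int].

Definition irreducible_system Phi : Prop :=
  Phi != fset0%fset /\
  forall A B : {fset V}, Phi = (A `|` B)%fset ->
    (forall a b, a \in A -> b \in B -> dotv a b = 0) ->
    A = fset0%fset \/ B = fset0%fset.

(* [h] is a normal to a hyperplane through 0 that meets no root. *)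
Definition positive_system Phi Pp : Prop :=
  exists h, (forall a, a \in Phi -> dotv a h != 0) /\
    Pp = [fset a in Phi | 0 < dotv a h]%fset.

(* Reflections are involutions, so the monoid they generate is a group. *)
Inductive weyl_group Phi : (V -> V) -> Prop :=
| weyl_id : weyl_group Phi id
| weyl_reflection a w :
    a \in Phi -> weyl_group Phi w -> weyl_group Phi (reflection a \o w).

(* Only the values of [k] on [Phi] matter. *)
Definition multiplicity Phi (k : V -> R) : Prop :=
  forall w a, weyl_group Phi w -> a \in Phi -> k (w a) = k a.

Definition rho Pp (k : V -> R) : V := 2^-1 *: \sum_(a <- Pp) k a *: a.

End RootSystems.

Section SmoothFunctions.
Context {R : realType} {n : nat}.
Local Notation V := 'rV[R]_n.
Local Notation C := (R[i]).

Definition iterD (s : seq V) (f : V -> R) : V -> R :=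
  foldr (fun v g => 'D_v g) f s.

Definition rsmooth (f : V -> R) : Prop :=
  forall s, continuous (iterD s f) /\ forall x v, derivable (iterD s f) x v.

(* Functions are complex valued, so that e^{<s,.>} is smooth for s complex. *)
Definition csmooth (f : V -> C) : Prop :=
  rsmooth (fun x => complex.Re (f x)) /\ rsmooth (fun x => complex.Im (f x)).

Definition cderive (v : V) (f : V -> C) (x : V) : C :=
  ('D_v (fun y => complex.Re (f y)) x) +i* ('D_v (fun y => complex.Im (f y)) x).

Definition csmooth_pred : {pred V -> C^o} := mem [set f | csmooth f].

Record Cinfty := MkCinfty {
  cinfty_fun :> V -> C^o;
  _ : cinfty_fun \in csmooth_pred }.

HB.instance Definition _ := [isSub for cinfty_fun].
HB.instance Definition _ := [Choice of Cinfty by <:].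

Lemma iterD_lin (s : seq V) (a : R) (f g : V -> R) : rsmooth f -> rsmooth g ->
  iterD s (a *: f + g) = a *: iterD s f + iterD s g.
Proof.
move=> sf sg; elim: s => //= v s ->; apply/funext => x /=.
rewrite deriveD ?deriveZ //; last 2 first.
- by apply: derivableZ; exact: (sf s).2.
- exact: (sg s).2.
- exact: (sf s).2.
Qed.

Lemma rsmooth_lin (a : R) (f g : V -> R) : rsmooth f -> rsmooth g ->
  rsmooth (a *: f + g).
Proof.
move=> sf sg s; rewrite iterD_lin //; split=> [x|x v].
  apply: (@continuousD _ _ _ (a *: iterD s f) (iterD s g)).
    exact: (continuousZl_tmp ((sf s).1 x)).
  exact: (sg s).1.
apply: (@derivableD _ _ _ (a *: iterD s f) (iterD s g)); last exact: (sg s).2.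
by apply: derivableZ; exact: (sf s).2.
Qed.

Lemma rsmooth0 : rsmooth (0 : V -> R).
Proof.
move=> s; suff -> : iterD s (0 : V -> R) = cst 0.
  by split=> [x|x v]; [exact: cst_continuous|exact: derivable_cst].
by elim: s => //= v s ->; apply/funext => x; rewrite derive_cst.
Qed.

Lemma csmooth_submod_closed : submod_closed csmooth_pred.
Proof.
split=> [|a f g /set_mem[sfr sfi] /set_mem[sgr sgi]]; apply: mem_set.
  by split; exact: rsmooth0.
split.
  have := rsmooth_lin (complex.Re a) sfr
    (rsmooth_lin (- complex.Im a) sfi sgr).
  congr rsmooth; apply/funext => x; rewrite !fctE /= addrA.
  by case: a (f x) (g x) => [ar ai] [fr fi] [gr gi] /=; rewrite -mulNr.
have := rsmooth_lin (complex.Re a) sfi (rsmooth_lin (complex.Im a) sfr sgi).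
congr rsmooth; apply/funext => x; rewrite !fctE /= addrA.
by case: a (f x) (g x) => [ar ai] [fr fi] [gr gi].
Qed.

HB.instance Definition _ :=
  GRing.isSubmodClosed.Build _ _ csmooth_pred csmooth_submod_closed.
HB.instance Definition _ := [SubChoice_isSubLmodule of Cinfty by <:].

Definition cpart (b : bool) : C -> R :=
  if b then @complex.Im R else @complex.Re R.

Definition Cinfty_iterD (i : bool * seq V) (f : Cinfty) :
    {family compact, V -> R} :=
  iterD i.2 (fun x => cpart i.1 (f x)).

(* The usual Frechet topology of C^oo(V): the coarsest one for which taking any
   iterated derivative (of the real or of the imaginary part) is continuous
   into V -> R with uniform convergence on compact sets. *)
HB.instance Definition _ := Topological.copy Cinfty
  (sup_topology (fun i => Topological.class (initial_topology (Cinfty_iterD i)))).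

Lemma Cinfty_cvgP (F : set_system Cinfty) (f : Cinfty) : Filter F ->
  F --> f <->
  forall i, {family compact, Cinfty_iterD i @ F --> Cinfty_iterD i f}.
Proof.
move=> FF; split=> [/cvg_sup Ff i A /initial_continuous|Ff]; first exact: Ff.
apply/cvg_sup => i A; rewrite (@nbhsE (initial_topology (Cinfty_iterD i))).
move=> -[_ [[B oB <-] Bf] BA]; apply: filterS BA _.
by apply: (Ff i); apply: open_nbhs_nbhs.
Qed.

Lemma iterD_rcons (s : seq V) (v : V) (f : V -> R) :
  iterD (rcons s v) f = iterD s ('D_v f).
Proof. by rewrite /iterD foldr_rcons. Qed.

Lemma cderive_smooth (v : V) (f : Cinfty) :
  (cderive v f : V -> C^o) \in csmooth_pred.
Proof.
have /set_mem[sfr sfi] := valP f; apply/mem_set.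
split=> s; rewrite -[X in iterD s X]/('D_v _) -iterD_rcons.
  exact: sfr.
exact: sfi.
Qed.

Definition Cinfty_derive (v : V) (f : Cinfty) : Cinfty :=
  MkCinfty (cderive_smooth v f).

End SmoothFunctions.
Arguments Cinfty : clear implicits.

Section DunklCherednik.
Context {R : realType} {n : nat}.
Local Notation V := 'rV[R]_n.
Implicit Types (Phi Pp : {fset V}) (k : V -> R) (a x xi : V) (f : V -> R[i]).

(* The quotient (f(x) - f(s_a x)) / (1 - e^{-<a,x>}) has a removable singularity
   along the hyperplane <a,x> = 0: there f(x) - f(s_a x) is asymptotic to
   (2 <a,x> / <a,a>) 'D_a f(x) and 1 - e^{-<a,x>} to <a,x>. *)
Definition dunkl_quotient a f x : R[i] :=
  if dotv a x == 0 then (2 / dotv a a)%:C * cderive a f x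
  else (f x - f (reflection a x)) / (1 - expR (- dotv a x))%:C.

Definition dunkl_cherednik Pp k xi f x : R[i] :=
  cderive xi f x
  + \sum_(a <- Pp) (k a * dotv a xi)%:C * dunkl_quotient a f x
  - (dotv (rho Pp k) xi)%:C * f x.

Definition trig_dunkl_intertwiner Pp k (T : Cinfty R n -> Cinfty R n) : Prop :=
  [/\ linear T,
      continuous T,
      forall xi (f : Cinfty R n) x,
        dunkl_cherednik Pp k xi (T f) x = T (Cinfty_derive xi f) x &
      forall f : Cinfty R n, T f 0 = f 0].

End DunklCherednik.

(* Main.v *)
(* Put U(x, y) = V_k (f (. + y)) (x).  Translations commute with derivatives, so
   the intertwining relation in the direction x says that the derivative of U at
   s = 0 along s |-> ((1 - s) x, y + s x) equals
     sum_a k(a) <a,x> / (1 - e^{-<a,x>}) (U(x, y) - U(s_a x, y)) - <rho,x> U(x, y),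
   where every coefficient k(a) <a,x> / (1 - e^{-<a,x>}) is nonnegative.  The
   path and the reflections of x both preserve the compact set
   |x| + |y| <= r.  Suppose e^{-C|x|} U, with C > |rho|, had a negative minimum
   there.  Then x != 0, because U(0, y) = f(y) >= 0, and minimality along the
   path gives U' + C|x| U >= 0 at s = 0; but all the differences
   U(x, y) - U(s_a x, y) are nonpositive, so U' + C|x| U <= (C|x| - <rho,x>) U < 0. *)
From HB Require Import structures.
Require Import Defs.
From mathcomp Require Import all_boot all_order all_algebra.
From mathcomp Require Import finmap.
From mathcomp Require Import all_classical all_reals all_analysis.
From mathcomp Require Import complex.
From mathcomp Require Import ring lra.

Set Implicit Arguments.
Unset Strict Implicit.
Unset Printing Implicit Defensive.

Import Order.TTheory GRing.Theory Num.Theory numFieldNormedType.Exports.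
Local Open Scope classical_set_scope.
Local Open Scope complex_scope.
Local Open Scope ring_scope.

(** * Euclidean norm, invariance under reflections, compact balls *)

Section Euclidean.
Context {R : realType} {n : nat}.
Local Notation V := 'rV[R]_n.
Implicit Types (a x y z : V) (c : R).

(** The built-in norm on row vectors is the maximum of the coordinates, which reflections do not
    preserve; the domain of the minimum principle has to be stable under them. *)
Definition enorm x : R := Num.sqrt (dotv x x).

Lemma dotvC x y : dotv x y = dotv y x.
Proof. by apply: eq_bigr => i _; rewrite mulrC. Qed.

Lemma dotvDl x y z : dotv (x + y) z = dotv x z + dotv y z.
Proof. by rewrite -big_split; apply: eq_bigr => i _; rewrite mxE mulrDl. Qed.

Lemma dotvZl c x y : dotv (c *: x) y = c * dotv x y.
Proof. by rewrite mulr_sumr; apply: eq_bigr => i _; rewrite mxE mulrA. Qed.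

Lemma dotvDr x y z : dotv x (y + z) = dotv x y + dotv x z.
Proof. by rewrite dotvC dotvDl !(dotvC x). Qed.

Lemma dotvZr c x y : dotv x (c *: y) = c * dotv x y.
Proof. by rewrite dotvC dotvZl dotvC. Qed.

Lemma dotv_ge0 x : 0 <= dotv x x.
Proof. by apply: sumr_ge0 => i _; rewrite -expr2 sqr_ge0. Qed.

Lemma dotv_eq0 x : (dotv x x == 0) = (x == 0).
Proof.
apply/eqP/eqP => [/eqP|->]; last by rewrite -(scale0r 0) dotvZl mul0r.
rewrite psumr_eq0 => [/allP x0|i _]; last by rewrite -expr2 sqr_ge0.
apply/rowP => i; rewrite mxE; apply/eqP.
by have := x0 i (mem_index_enum _); rewrite mulf_eq0 orbb.
Qed.

Lemma enorm_ge0 x : 0 <= enorm x. Proof. exact: sqrtr_ge0. Qed.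

Lemma enorm0 : enorm 0 = 0.
Proof. by rewrite /enorm -(scale0r 0) dotvZl mul0r sqrtr0. Qed.

Lemma enorm_gt0 x : x != 0 -> 0 < enorm x.
Proof. by move=> x0; rewrite sqrtr_gt0 lt0r dotv_eq0 x0 dotv_ge0. Qed.

Lemma sqr_enorm x : enorm x ^+ 2 = dotv x x.
Proof. by rewrite sqr_sqrtr ?dotv_ge0. Qed.

Lemma enormZ c x : enorm (c *: x) = `|c| * enorm x.
Proof.
by rewrite /enorm dotvZl dotvZr mulrA -expr2 sqrtrM ?sqr_ge0 // sqrtr_sqr.
Qed.

(** Cauchy-Schwarz: for nonzero vectors, the square of the norm of |y| x - |x| y expands to 2 |x|
    |y| (|x| |y| - <x,y>). *)
Lemma dotv_le_enorm x y : dotv x y <= enorm x * enorm y.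
Proof.
have [->|/enorm_gt0 x0] := eqVneq x 0.
  by rewrite enorm0 mul0r -(scale0r 0) dotvZl mul0r.
have [->|/enorm_gt0 y0] := eqVneq y 0.
  by rewrite enorm0 mulr0 -(scale0r 0) dotvZr mul0r.
have := dotv_ge0 (enorm y *: x + (- enorm x) *: y).
rewrite !(dotvDl, dotvDr, dotvZl, dotvZr) -!sqr_enorm (dotvC y x).
have xy0 := mulr_gt0 x0 y0.
rewrite (_ : _ + _ = 2 * (enorm x * enorm y) * (enorm x * enorm y - dotv x y)).
  by rewrite pmulr_rge0 ?subr_ge0 // mulr_gt0.
by ring.
Qed.

Lemma enormD x y : enorm (x + y) <= enorm x + enorm y.
Proof.
rewrite -ler_sqr ?nnegrE ?addr_ge0 ?enorm_ge0 // sqr_enorm.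
rewrite !(dotvDl, dotvDr) (dotvC y x) sqrrD -!sqr_enorm.
have := dotv_le_enorm x y; lra.
Qed.

Lemma enorm_reflection a x : enorm (reflection a x) = enorm x.
Proof.
rewrite /enorm /reflection; congr Num.sqrt.
(* For a = 0 the subtracted term is a multiple of the zero vector, so the reflection is the identity
   whatever the value of the quotient. *)
have [->|a0] := eqVneq a 0; first by rewrite scaler0 subr0.
rewrite -scaleNr !(dotvDl, dotvDr, dotvZl, dotvZr) (dotvC x a).
by field; rewrite dotv_eq0.
Qed.

Lemma continuous_dotv (T : topologicalType) (f g : T -> V) :
  continuous f -> continuous g -> continuous (fun t => dotv (f t) (g t)).
Proof.
move=> cf cg.
have cadd : continuous (fun p : R * R => p.1 + p.2) by exact: add_continuous.
apply: (continuous_big cadd) => i _ t.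
have ccoord (h : T -> V) : continuous h -> continuous (fun t => h t 0 i).
  move=> ch u; apply: (@continuous_comp _ _ _ h (fun x : V => x 0 i)).
    exact: ch.
  exact: coord_continuous.
by apply: cvgM; [exact: (ccoord f)|exact: (ccoord g)].
Qed.

Lemma continuous_enorm : continuous enorm.
Proof.
have ci : continuous (@idfun V) by move=> y; exact: cvg_id.
move=> y; apply: (@continuous_comp _ _ _ (fun z : V => dotv z z) Num.sqrt).
  exact: (continuous_dotv ci ci).
exact: sqrt_continuous.
Qed.

Lemma enorm_coord x (i : 'I_n) : `|x 0 i| <= enorm x.
Proof.
rewrite -sqrtr_sqr; apply: ler_wsqrtr; rewrite /dotv (bigD1 i) //= expr2.
by rewrite lerDl; apply: sumr_ge0 => j _; rewrite -expr2 sqr_ge0.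
Qed.

(** The ball is closed and lies in a cube, a product of compact segments. *)
Lemma compact_enorm_le r : compact [set x | enorm x <= r].
Proof.
apply: (@subclosed_compact _ _ [set x : V | forall i, `[- r, r]%classic (x 0 i)]).
- apply: (@closed_comp _ _ enorm [set t | t <= r]).
    by move=> x _; exact: continuous_enorm.
  exact: closed_le.
- apply: (@rV_compact R^o n (fun=> `[- r, r]%classic)) => _.
  exact: segment_compact.
- move=> x /= xr i; rewrite in_itv /= -ler_norml.
  exact: le_trans (enorm_coord _ _) xr.
Qed.

End Euclidean.

(** * Mean values along lines, symmetry of mixed derivatives, uniform translation *)

Section Lines.
Context {R : realType} {n : nat}.
Local Notation V := 'rV[R]_n.
Implicit Types (g : V -> R) (u v x y z : V) (s t : R).

Lemma is_derive_line g x v t : derivable g (x + t *: v) v ->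
  is_derive t (1 : R) (fun s => g (x + s *: v)) ('D_v g (x + t *: v)).
Proof.
have E : (fun h : R => h^-1 *: (g (h *: v + (x + t *: v)) - g (x + t *: v)))
       = (fun h : R => h^-1 *: (g (x + (h *: 1 + t) *: v) - g (x + t *: v))).
  by apply/funext => h; rewrite scalerDl addrCA [h *: 1]mulr1.
rewrite /derivable /derive /= E => dg.
by split; rewrite /derivable /derive /=.
Qed.

Lemma mvt_line g x v t : (forall z, derivable g z v) -> 0 <= t ->
  exists2 s, 0 <= s <= t & g (x + t *: v) - g x = t * 'D_v g (x + s *: v).
Proof.
move=> dg t0.
have dl s : is_derive s (1 : R) (fun s => g (x + s *: v)) ('D_v g (x + s *: v)).
  exact: is_derive_line.
have cl : {within `[0, t], continuous (fun s => g (x + s *: v))}.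
  apply: continuous_subspaceT => s; apply/differentiable_continuous.
  by apply/derivable1_diffP; have [] := dl s.
have [s] := MVT_segment t0 (fun s _ => dl s) cl.
rewrite in_itv /= scale0r addr0 subr0 mulrC => ? ?; by exists s.
Qed.

Lemma derive_shift_comp g y z v : derivable g (z + y) v ->
  derivable (g \o shift y) z v /\ 'D_v (g \o shift y) z = 'D_v g (z + y).
Proof. by rewrite /derivable /derive /=; under eq_fun do rewrite addrA. Qed.

(** The mean value theorem is used twice: along v for z |-> g(z + t u) - g(z), then along u for
    ['D_v g]. *)
Lemma second_difference g x u v t :
  (forall z, derivable g z v) -> (forall z, derivable ('D_v g) z u) -> 0 <= t ->
  exists r s, [/\ 0 <= r <= t, 0 <= s <= t &
    (g (x + t *: u + t *: v) - g (x + t *: v)) - (g (x + t *: u) - g x)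
    = t * (t * 'D_u ('D_v g) (x + r *: u + s *: v))].
Proof.
move=> dv du t0.
pose h z := g (z + t *: u) - g z.
have dshift z := derive_shift_comp (dv (z + t *: u)).
have dh z : derivable h z v by apply: derivableB => //; exact: (dshift z).1.
have hE z : 'D_v h z = 'D_v g (z + t *: u) - 'D_v g z.
  by rewrite deriveB //; [rewrite (dshift z).2|exact: (dshift z).1].
have [s st] := mvt_line x dh t0; rewrite hE => es.
have [r rt er] := mvt_line (x + s *: v) du t0.
exists r, s; split => //; rewrite (addrAC x (r *: u)) -er -es.
by rewrite /h (addrAC x (t *: u)).
Qed.

Lemma near_two_parameter (A : V -> R) x u v e : {for x, continuous A} -> 0 < e ->
  exists2 d, 0 < d & forall r s, `|r| < d -> `|s| < d ->
    `|A (x + r *: u + s *: v) - A x| < e.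
Proof.
move=> cA e0.
have /cvgrPdist_lt /(_ e e0) :
    A (x + w.1 *: u + w.2 *: v) @[w --> (0 : R, 0 : R)] --> A x.
  have cl : (x + w.1 *: u + w.2 *: v) @[w --> (0 : R, 0 : R)]
      --> x + 0 *: u + 0 *: v.
    apply: cvgD; [apply: cvgD; first exact: cvg_cst|].
      by apply: cvgZr_tmp; exact: cvg_fst.
    by apply: cvgZr_tmp; exact: cvg_snd.
  by rewrite !scale0r !addr0 in cl; exact: (cvg_comp _ _ cl cA).
move=> /nbhs_ballP[d /= d0 H].
exists d => // r s rd sd; rewrite distrC.
by apply: (H (r, s)); split; rewrite /ball /= sub0r normrN.
Qed.

(** The second difference is symmetric in u and v, so the two mixed derivatives agree at two points
    that tend to x with t; continuity at x finishes. *)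
Lemma derive_symmetric g u v x :
  (forall z, derivable g z u) -> (forall z, derivable g z v) ->
  (forall z, derivable ('D_v g) z u) -> (forall z, derivable ('D_u g) z v) ->
  {for x, continuous ('D_u ('D_v g))} -> {for x, continuous ('D_v ('D_u g))} ->
  'D_u ('D_v g) x = 'D_v ('D_u g) x.
Proof.
move=> du dv duv dvu cuv cvu.
apply/eqP; rewrite -subr_eq0 -normr_le0; apply/ler_addgt0Pl => e e0; rewrite addr0.
have e2 : 0 < e / 2 by rewrite divr_gt0.
have [d1 d1_gt0 H1] := near_two_parameter u v cuv e2.
have [d2 d2_gt0 H2] := near_two_parameter v u cvu e2.
(* Halving makes every parameter of the closed interval [0, t] strictly smaller than both radii. *)
pose t := Num.min d1 d2 / 2.
have t0 : 0 < t by rewrite divr_gt0 // lt_min d1_gt0.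
have small r : 0 <= r <= t -> `|r| < d1 /\ `|r| < d2.
  move=> /andP[r0 rt]; rewrite ger0_norm //; apply/andP; rewrite -lt_min.
  apply: le_lt_trans rt _; rewrite /t ltr_pdivrMr //.
  by rewrite ltr_pMr ?ltr1n // lt_min d1_gt0.
have [r [s [/small[r1 r2] /small[s1 s2] e1]]] :=
  second_difference x dv duv (ltW t0).
have [r' [s' [/small[r1' r2'] /small[s1' s2'] e1']]] :=
  second_difference x du dvu (ltW t0).
have : 'D_u ('D_v g) (x + r *: u + s *: v) = 'D_v ('D_u g) (x + r' *: v + s' *: u).
  apply: (mulfI (lt0r_neq0 t0)); apply: (mulfI (lt0r_neq0 t0)).
  rewrite -e1 -e1' (addrAC x (t *: v)).
  move: (g (x + t *: u + t *: v)) (g (x + t *: v)) (g (x + t *: u)) (g x).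
  by move=> a b c d; ring.
have := H1 r s r1 s1; have := H2 r' s' r2' s2'.
move: ('D_u ('D_v g) (x + _ + _)) => a' h2 h1 ee.
rewrite {a'}ee in h1; move: h1 h2.
move: ('D_v ('D_u g) (x + _ + _)) ('D_u ('D_v g) x) ('D_v ('D_u g) x) => a b c h1 h2.
rewrite (_ : b - c = - (a - b) + (a - c)); last by ring.
by apply: le_trans (ler_normD _ _) _; rewrite normrN; lra.
Qed.

(** The innermost derivative is moved outwards past each direction of [s] by symmetry of mixed
    derivatives. *)
Lemma iterD_derive g (s : seq V) v : rsmooth g ->
  Defs.iterD s ('D_v g) = 'D_v (Defs.iterD s g).
Proof.
move=> sg; rewrite -iterD_rcons; elim: s => //= u s ->.
apply/funext => x; apply: derive_symmetric => [z|z|z|z||].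
- exact: (sg s).2.
- exact: (sg s).2.
- exact: (sg (v :: s)).2.
- exact: (sg (u :: s)).2.
- exact: (sg [:: u, v & s]).1.
- exact: (sg [:: v, u & s]).1.
Qed.

(** Joint continuity at (z, y) gives a neighbourhood of y that serves all points near z; compactness
    of [K] then gives one that serves all of [K]. *)
Lemma uniform_shift_continuous g (K : set V) y e : continuous g -> compact K ->
  0 < e -> \forall y' \near y, forall z, K z -> `|g (z + y') - g (z + y)| < e.
Proof.
move=> cg /compact_near_coveringP cK e0.
apply: (cK _ (nbhs y) (fun y' z => `|g (z + y') - g (z + y)| < e)) => z _.
have e2 : 0 < e / 2 by rewrite divr_gt0.
have c1 : g (w.1 + w.2) @[w --> (z, y)] --> g (z + y).
  apply: (@continuous_comp _ _ _ (fun w : V * V => w.1 + w.2) g (z, y)).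
    by apply: cvgD; [exact: cvg_fst|exact: cvg_snd].
  exact: cg.
have c2 : g (w.1 + y) @[w --> (z, y)] --> g (z + y).
  apply: (@continuous_comp _ _ _ (fun w : V * V => w.1 + y) g (z, y)).
    by apply: cvgD; [exact: cvg_fst|exact: cvg_cst].
  exact: cg.
have /cvgrPdist_lt /(_ e e0) :
    (g (w.1 + w.2) - g (w.1 + y)) @[w --> (z, y)] --> (0 : R).
  by rewrite -(subrr (g (z + y))); exact: cvgB.
by apply: filterS => -[a b] /=; rewrite sub0r normrN.
Qed.

End Lines.

(** * Translations and evaluation on the Fréchet space of smooth functions *)

Section SmoothSpace.
Context {R : realType} {n : nat}.
Local Notation V := 'rV[R]_n.
Local Notation CV := (Cinfty R n).
Implicit Types (f : CV) (g : V -> R) (s : seq V) (x y z : V) (b : bool).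

Definition part b f : V -> R := fun x => cpart b (f x).

Lemma rsmooth_part b f : rsmooth (part b f).
Proof. by have /set_mem[sr si] := valP f; case: b. Qed.

Lemma part_derive b f x : part b (Cinfty_derive x f) = 'D_x (part b f).
Proof. by case: b. Qed.

Lemma part_quotient b (c : R) f h :
  part b (c%:C *: (f - h)) = c *: (part b f - part b h).
Proof.
apply/funext => z.
rewrite -[RHS]/(c * (part b f z - part b h z))
  -[LHS]/(cpart b (c%:C * (f z - h z))).
rewrite /part; case: (f z) (h z) => [fr fi] [hr hi]; case: b => /=; ring.
Qed.

Lemma iterD_shift s g y : rsmooth g ->
  Defs.iterD s (g \o shift y) = Defs.iterD s g \o shift y.
Proof.
move=> sg; elim: s => //= v s ->; apply/funext => z.
exact: (derive_shift_comp ((sg s).2 _ _)).2.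
Qed.

Lemma rsmooth_shift g y : rsmooth g -> rsmooth (g \o shift y).
Proof.
move=> sg s; rewrite iterD_shift //; split=> [z|z v].
  apply: (@continuous_comp _ _ _ (shift y : V -> V) (Defs.iterD s g) z).
    exact: (cvgD cvg_id (cvg_cst y)).
  exact: (sg s).1.
exact: (derive_shift_comp ((sg s).2 _ _)).1.
Qed.

Lemma Cinfty_shift_subproof y f :
  ((fun z => f (z + y)) : V -> R[i]^o) \in csmooth_pred.
Proof.
apply/mem_set; split.
  exact: (rsmooth_shift y (rsmooth_part false f)).
exact: (rsmooth_shift y (rsmooth_part true f)).
Qed.

Definition Cinfty_shift y f : CV := MkCinfty (Cinfty_shift_subproof y f).

(** Turns the topology into epsilon estimates for iterated derivatives on compact sets, the form in
    which the limits below are checked. *)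
Lemma Cinfty_cvg_nearP (F : set_system CV) f : Filter F ->
  F --> f <-> forall b s (K : set V) e, compact K -> 0 < e ->
    \forall h \near F, forall z, K z ->
      `|Defs.iterD s (part b h) z - Defs.iterD s (part b f) z| < e.
Proof.
move=> FF; rewrite Cinfty_cvgP; split=> [Ff b s K e cK e0|H [b s]].
  have /fam_cvgP /(_ K cK) := Ff (b, s).
  move=> /(_ [set h | forall z, K z -> ball (Defs.iterD s (part b f) z) e (h z)]).
  have /[swap] /[apply] : nbhs (Cinfty_iterD (b, s) f : {uniform` K -> R})
      [set h | forall z, K z -> ball (Defs.iterD s (part b f) z) e (h z)].
    apply/uniform_nbhs; exists [set p | ball p.1 e p.2]; split => //.
    by rewrite -entourage_ballE; exists e.
  move=> HF; apply: (@filterS _ F _ _ _ _ HF) => h /= H z Kz.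
  by rewrite distrC; exact: H.
apply/fam_cvgP => K cK A /uniform_nbhs[E [/= entE EA]].
move: entE; rewrite -entourage_ballE => -[e /= e0 eE].
apply: filterS (H b s K e cK e0) => h Hh; apply: EA => z Kz.
by apply: eE; rewrite /= /ball /= distrC; exact: Hh.
Qed.

Lemma Cinfty_shift_continuous f : continuous (Cinfty_shift ^~ f).
Proof.
move=> y; have FF := fmap_filter (Cinfty_shift ^~ f) (nbhs_filter y).
apply: (iffRL (Cinfty_cvg_nearP _ FF)) => b s K e cK e0.
have sf := rsmooth_part b f.
have := uniform_shift_continuous y (sf s).1 cK e0.
apply: filterS => y' H z Kz.
rewrite -[part b (Cinfty_shift y' f)]/(part b f \o shift y').
rewrite -[part b (Cinfty_shift y f)]/(part b f \o shift y).
by rewrite !iterD_shift //; exact: H.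
Qed.

Lemma iterD_quotient s (c : R) g h : rsmooth g -> rsmooth h ->
  Defs.iterD s (c *: (g - h)) = c *: (Defs.iterD s g - Defs.iterD s h).
Proof.
move=> sg sh.
have sgh : rsmooth (g - h) by rewrite addrC -scaleN1r; exact: rsmooth_lin.
(* [iterD_lin] treats combinations [a *: f + g], so a zero summand is added; its iterated derivative
   is shown to vanish at the end by taking a = -1 and f = g = 0. *)
rewrite -[in LHS](addr0 (c *: _)) iterD_lin //; last exact: rsmooth0.
rewrite [g - h]addrC -scaleN1r iterD_lin // scaleN1r [- _ + _]addrC.
have := iterD_lin s (-1) (@rsmooth0 R n) (@rsmooth0 R n).
by rewrite scaleN1r addNr scaleN1r addNr => ->; rewrite addr0.
Qed.

(** Translation is differentiable in the Fréchet topology: by the mean value theorem each iterated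
    derivative of the quotient is the same iterated derivative of the [x]-derivative of f at a
    slightly displaced point, and uniform continuity on compact sets controls the displacement. *)
Lemma Cinfty_shift_derive f x y :
  (s^-1)%:C *: (Cinfty_shift (y + s *: x) f - Cinfty_shift y f) @[s --> 0^'+]
    --> Cinfty_shift y (Cinfty_derive x f).
Proof.
have FF := fmap_filter (fun s : R =>
  (s^-1)%:C *: (Cinfty_shift (y + s *: x) f - Cinfty_shift y f))
  (at_right_proper_filter (0 : R)).
apply: (iffRL (Cinfty_cvg_nearP _ FF)) => b s K e cK e0.
have sf := rsmooth_part b f; have sdf := rsmooth_part b (Cinfty_derive x f).
have /nbhs_ballP[d /= d0 H] := uniform_shift_continuous y (sdf s).1 cK e0.
have c0 : (y + r *: x) @[r --> (0:R)] --> y.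
  rewrite -{2}(addr0 y) -(scale0r x).
  by apply: cvgD; [exact: cvg_cst|apply: cvgZr_tmp; exact: cvg_id].
have /nbhs_ballP[d' /= d'0 H'] : \forall r \near (0:R), ball y d (y + r *: x).
  by apply: c0; exact: nbhsx_ballx.
rewrite near_simpl; near=> t => z Kz.
have t0 : 0 < t by near: t; exact: nbhs_right_gt.
have td : t < d' by near: t; exact: nbhs_right_lt.
rewrite part_quotient.
rewrite -[part b (Cinfty_shift (y + _) f)]/(part b f \o shift (y + t *: x)).
rewrite -[part b (Cinfty_shift y f)]/(part b f \o shift y).
rewrite -[part b (Cinfty_shift y _)]/(part b (Cinfty_derive x f) \o shift y).
rewrite iterD_quotient; [|exact: rsmooth_shift|exact: rsmooth_shift].
rewrite !iterD_shift // -[X in `|X - _|]/(t^-1 *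
  (Defs.iterD s (part b f) (z + (y + t *: x)) - Defs.iterD s (part b f) (z + y))).
rewrite addrA.
have [r /andP[r0 rt] ->] :=
  mvt_line (z + y) (fun w => (sf s).2 w x) (ltW t0).
have -> : 'D_x (Defs.iterD s (part b f)) (z + y + r *: x) =
    Defs.iterD s (part b (Cinfty_derive x f)) (z + y + r *: x).
  by rewrite part_derive iterD_derive.
rewrite mulKf ?lt0r_neq0 // -addrA /=.
apply: H Kz; apply: H'; rewrite /ball /= sub0r normrN ger0_norm //.
exact: le_lt_trans rt td.
Unshelve. all: by end_near. Qed.

(** Joint continuity of evaluation. Eventually p stays in the ball of radius |z| + 1, where h is
    uniformly close to f; continuity of f absorbs the motion of p. *)
Lemma cvg_eval (I : Type) (F : set_system I) (h : I -> CV) (p : I -> V) f z :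
  Filter F -> h i @[i --> F] --> f -> p i @[i --> F] --> z ->
  part false (h i) (p i) @[i --> F] --> part false f z.
Proof.
move=> FF hf pz.
have pe : enorm (p i) @[i --> F] --> enorm z.
  exact: (cvg_comp _ _ pz (@continuous_enorm R n z)).
have pp : part false f (p i) @[i --> F] --> part false f z.
  exact: (cvg_comp _ _ pz ((rsmooth_part false f [::]).1 z)).
apply/cvgrPdist_lt => e e0; have e2 : 0 < e / 2 by rewrite divr_gt0.
have /Cinfty_cvg_nearP /(_ false [::] _ _
  (compact_enorm_le (r := enorm z + 1)) e2) := hf.
move/cvgrPdist_lt: pp => /(_ _ e2); move/cvgrPdist_lt: pe => /(_ 1 ltr01).
rewrite !near_simpl => pe pp H; near=> i.
have : `|part false (h i) (p i) - part false f (p i)| < e / 2.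
  have H1 : enorm (p i) <= enorm z + 1.
    have : `|enorm z - enorm (p i)| < 1 by near: i.
    by rewrite ltr_distl => /andP[]; lra.
  by move: (p i) H1; near: i.
have : `|part false f z - part false f (p i)| < e / 2 by near: i.
rewrite (_ : part false f z - part false (h i) (p i) =
  (part false f z - part false f (p i)) -
  (part false (h i) (p i) - part false f (p i))).
  by move=> h1 h2; apply: le_lt_trans (ler_normB _ _) _; lra.
by rewrite opprB addrA subrK.
Unshelve. all: by end_near. Qed.

End SmoothSpace.

(** * The minimum principle and positivity *)

Section Positivity.
Context {R : realType} {n : nat}.
Local Notation V := 'rV[R]_n.
Local Notation CV := (Cinfty R n).
Implicit Types (f h : CV) (x y z : V).

Lemma cvg_radial_quotient (g : V -> R) x :
  (forall z, derivable g z x) -> {for x, continuous ('D_x g)} ->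
  s^-1 * (g (x - s *: x) - g x) @[s --> 0^'+] --> - 'D_x g x.
Proof.
move=> dg cg; apply/cvgrPdist_lt => e e0.
(* Only one parameter is needed, so the second direction is 0. *)
have [d d0 H] := near_two_parameter x 0 cg e0.
near=> s.
have s0 : 0 < s by near: s; exact: nbhs_right_gt.
have sd : s < d by near: s; exact: nbhs_right_lt.
have [r /andP[r0 rs]] := mvt_line (x - s *: x) dg (ltW s0).
rewrite subrK => E; rewrite -[g _ - g x]opprB E mulrN mulKf ?lt0r_neq0 // opprK addrC.
have := H (r - s) 0; rewrite normr0 d0 scaler0 addr0 scalerBl addrCA addrC addrAC.
apply => //; rewrite ler0_norm ?subr_le0 // opprB; lra.
Unshelve. all: by end_near. Qed.

Lemma Cinfty_derive_shift x y f :
  Cinfty_derive x (Cinfty_shift y f) = Cinfty_shift y (Cinfty_derive x f).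
Proof.
apply/val_inj/funext => z /=; rewrite /cderive.
have H b := (derive_shift_comp ((rsmooth_part b f [::]).2 (z + y) x)).2.
by congr (_ +i* _); [exact: (H false)|exact: (H true)].
Qed.

Lemma Re_sum (I : Type) (r : seq I) (F : I -> R[i]) :
  complex.Re (\sum_(i <- r) F i) = \sum_(i <- r) complex.Re (F i).
Proof. by apply: big_morph => // -[a b] [c d]. Qed.

Lemma divr_1BexpN_gt0 (z : R) : z != 0 -> 0 < z / (1 - expR (- z)).
Proof.
move=> /lt_total /orP[z0|z0].
  rewrite -[z]opprK mulNr -mulrN -invrN opprB opprK divr_gt0 ?oppr_gt0 //.
  by rewrite subr_gt0 pexpR_gt1 ?oppr_gt0.
by rewrite divr_gt0 // subr_gt0 expR_lt1 oppr_lt0.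
Qed.

Lemma dunkl_cherednik_le (Pp : {fset V}) (k : V -> R) h x :
  (forall a, a \in Pp -> 0 <= k a) ->
  (forall a, part false h x <= part false h (reflection a x)) ->
  complex.Re (dunkl_cherednik Pp k x h x) <=
    'D_x (part false h) x - dotv (rho Pp k) x * part false h x.
Proof.
move=> k0 hx; rewrite /dunkl_cherednik.
have ReM (c : R) (w : R[i]) : complex.Re (c%:C * w) = c * complex.Re w.
  by case: w => a b /=; ring.
have ReD (v w : R[i]) : complex.Re (v + w) = complex.Re v + complex.Re w.
  by case: v w => [a b] [c d].
have ReN (w : R[i]) : complex.Re (- w) = - complex.Re w by case: w.
rewrite !ReD ReN ReM Re_sum lerB // gerDl.
rewrite big_seq; apply: sumr_le0 => a aPp; rewrite ReM /dunkl_quotient.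
(* On the hyperplane <a,x> = 0 the factor <a,x> kills the term, whatever the value of the quotient
   there. *)
case: ifPn => [/eqP->|ax0]; first by rewrite mulr0 mul0r.
rewrite -fmorphV [X in complex.Re X]mulrC ReM ReD ReN mulrA -[X in X * _]mulrA.
apply: mulr_ge0_le0; last by rewrite subr_le0; exact: hx.
by apply: mulr_ge0; [exact: k0|exact/ltW/divr_1BexpN_gt0].
Qed.

Section Flow.
Variables (Pp : {fset V}) (k : V -> R) (T : CV -> CV).
Hypothesis TI : trig_dunkl_intertwiner Pp k T.

Let U f x y : R := part false (T (Cinfty_shift y f)) x.

Lemma continuous_flow f : continuous (fun p : V * V => U f p.1 p.2).
Proof.
have [_ cT _ _] := TI.
move=> [x y]; apply: cvg_eval; last exact: cvg_fst.
apply: (@cvg_comp _ _ _ (fun p : V * V => Cinfty_shift p.2 f) T _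
  (nbhs (Cinfty_shift y f))); last exact: cT.
apply: (@cvg_comp _ _ _ snd (Cinfty_shift ^~ f) _ (nbhs y)).
  exact: cvg_snd.
exact: Cinfty_shift_continuous.
Qed.

(** The increment is split at (x - s x, y). Moving y gives [T] applied to a difference quotient of
    translates, whose limit is the Dunkl-Cherednik term by continuity of [T] and intertwining;
    moving x gives minus the radial derivative. *)
Lemma cvg_flow f x y :
  s^-1 * (U f (x - s *: x) (y + s *: x) - U f x y) @[s --> 0^'+] -->
    complex.Re (dunkl_cherednik Pp k x (T (Cinfty_shift y f)) x)
      - 'D_x (part false (T (Cinfty_shift y f))) x.
Proof.
have [lT cT DT _] := TI.
pose h := T (Cinfty_shift y f).
have sh := rsmooth_part false h.
pose q s := s^-1%:C *: (Cinfty_shift (y + s *: x) f - Cinfty_shift y f).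
have Tq s : T (q s) = s^-1%:C *: (T (Cinfty_shift (y + s *: x) f) - h).
  pose TL := GRing.isLinear.Build _ _ _ _ T lT.
  pose TT : {linear CV -> CV} := HB.pack T TL.
  by rewrite -[T]/(TT : CV -> CV) /q linearZ linearB.
have -> : (fun s => s^-1 * (U f (x - s *: x) (y + s *: x) - U f x y)) =
    (fun s => part false (T (q s)) (x - s *: x) +
      s^-1 * (part false h (x - s *: x) - part false h x)).
  apply/funext => s; rewrite Tq part_quotient.
  rewrite -[X in _ = X + _]/(s^-1 * (U f (x - s *: x) (y + s *: x) -
    part false h (x - s *: x))).
  by rewrite -mulrDr addrA subrK.
rewrite DT Cinfty_derive_shift; apply: cvgD; last first.
  by apply: cvg_radial_quotient => [z|]; [exact: (sh [::]).2|exact: (sh [:: x]).1].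
apply: cvg_eval.
  apply: (@cvg_comp _ _ _ q T _ (nbhs (Cinfty_shift y (Cinfty_derive x f)))).
    exact: Cinfty_shift_derive.
  exact: cT.
have c0 : x - s *: x @[s --> 0^'+] --> x - 0 *: x.
  apply: cvg_at_right_filter; apply: cvgB; first exact: cvg_cst.
  by apply: cvgZr_tmp; exact: cvg_id.
by rewrite scale0r subr0 in c0.
Qed.

Lemma intertwiner_Re_ge0 f x : (forall a, a \in Pp -> 0 <= k a) ->
  (forall z, 0 <= part false f z) -> 0 <= part false (T f) x.
Proof.
move=> k0 f0; have [_ _ _ T0] := TI.
(* All translates are treated together, since the path changes y; y = 0 returns f itself. *)
suff H y : 0 <= U f x y.
  have := H 0; rewrite /U; congr (_ <= part false (T _) _).
  by apply/val_inj/funext => z /=; rewrite addr0.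
rewrite leNgt; apply/negP => Uneg.
(* By Cauchy-Schwarz this gives C |x| - <rho,x> >= |x|, which is positive for x != 0. *)
pose C := enorm (rho Pp k) + 1.
pose w (p : V * V) := expR (- (C * enorm p.1)) * U f p.1 p.2.
pose K := [set p : V * V | enorm p.1 + enorm p.2 <= enorm x + enorm y].
have cn1 : continuous (fun p : V * V => enorm p.1).
  move=> p; apply: (@continuous_comp _ _ _ fst enorm); first exact: cvg_fst.
  exact: continuous_enorm.
have cn2 : continuous (fun p : V * V => enorm p.2).
  move=> p; apply: (@continuous_comp _ _ _ snd enorm); first exact: cvg_snd.
  exact: continuous_enorm.
have cK : compact K.
  pose B := [set z : V | enorm z <= enorm x + enorm y].
  apply: (@subclosed_compact _ _ (B `*` B)).
  - apply: (@closed_comp _ _ (fun p : V * V => enorm p.1 + enorm p.2)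
      [set t | t <= enorm x + enorm y]); last exact: closed_le.
    by move=> p _; apply: cvgD; [exact: cn1|exact: cn2].
  - by apply: compact_setX; exact: compact_enorm_le.
  - move=> [a b]; rewrite /K /B /= => Kab.
    by have := enorm_ge0 a; have := enorm_ge0 b; split => /=; lra.
have cw : continuous w.
  move=> p; apply: cvgM; last exact: continuous_flow.
  apply: (@continuous_comp _ _ _ (fun p : V * V => - (C * enorm p.1)) expR).
    by apply: cvgN; apply: cvgM; [exact: cvg_cst|exact: cn1].
  exact: continuous_expR.
have Kxy : K (x, y) by rewrite /K /=.
have [[x0 y0] /set_mem Kp minp] :=
  compact_EVT_min (ex_intro _ _ Kxy) cK (continuous_subspaceT cw).
have U0 : U f x0 y0 < 0.
  have := le_lt_trans (minp _ (mem_set Kxy)) _.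
  by move=> /(_ 0); rewrite /w !pmulr_rlt0 ?expR_gt0 //=; exact.
have x00 : x0 != 0.
  apply: contraTneq U0 => ->; rewrite -leNgt /U /part T0.
  exact: f0.
have Urefl a : U f x0 y0 <= U f (reflection a x0) y0.
  have : K (reflection a x0, y0) by rewrite /K /= enorm_reflection.
  move=> /mem_set /minp; rewrite /w /= enorm_reflection.
  by rewrite ler_pM2l ?expR_gt0.
have Ule s : 0 <= s <= 1 ->
    U f x0 y0 <= expR (s * (C * enorm x0)) * U f (x0 - s *: x0) (y0 + s *: x0).
  move=> /andP[s0 s1].
  have e1 : enorm (x0 - s *: x0) = (1 - s) * enorm x0.
    by rewrite -{1}(scale1r x0) -scalerBl enormZ ger0_norm // subr_ge0.
  have : K (x0 - s *: x0, y0 + s *: x0).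
    rewrite /K /= e1; apply: le_trans Kp => /=.
    apply: le_trans (lerD (lexx _) (enormD _ _)) _.
    by rewrite enormZ ger0_norm //; lra.
  move=> /mem_set /minp; rewrite /w /= e1.
  (* Clearing the weight at [x0] leaves the exponent C |x0| - C (1 - s) |x0| = s C |x0|. *)
  rewrite -(ler_pM2l (expR_gt0 (C * enorm x0))) !mulrA -!expRD subrr expR0 mul1r.
  by congr (_ <= expR _ * _); ring.
have cU : U f (x0 - s *: x0) (y0 + s *: x0) @[s --> 0^'+] --> U f x0 y0.
  apply: cvg_at_right_filter.
  apply: (@cvg_comp _ _ _ (fun s : R => (x0 - s *: x0, y0 + s *: x0))
    (fun p : V * V => U f p.1 p.2) _ (nbhs (x0, y0))); last
    exact: (@continuous_flow f (x0, y0)).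
  have c0 : s *: x0 @[s --> (0 : R)] --> 0 *: x0.
    by apply: cvgZr_tmp; exact: cvg_id.
  have c1 := cvg_pair (cvgB (cvg_cst x0) c0) (cvgD (cvg_cst y0) c0).
  by rewrite scale0r subr0 addr0 in c1; exact: c1.
have := @cvg_flow f x0 y0.
set D := complex.Re _ - _ => cD.
have cS : s^-1 * (U f (x0 - s *: x0) (y0 + s *: x0) - U f x0 y0) +
    C * enorm x0 * U f (x0 - s *: x0) (y0 + s *: x0) @[s --> 0^'+] -->
    D + C * enorm x0 * U f x0 y0.
  by apply: cvgD => //; apply: cvgM => //; exact: cvg_cst.
have : 0 <= D + C * enorm x0 * U f x0 y0.
  rewrite -(cvg_lim (@Rhausdorff R) cS).
  apply: limr_ge; first by apply: cvgP cS.
  near=> s.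
  have s0 : 0 < s by near: s; exact: nbhs_right_gt.
  have s1 : s < 1 by near: s; exact: nbhs_right_lt.
  have Us : U f (x0 - s *: x0) (y0 + s *: x0) < 0.
    by near: s; exact: (cvgr_lt _ cU).
  have := Ule s; rewrite (ltW s0) (ltW s1) => /(_ isT) H.
  (* As U is negative at the displaced point, multiplying 1 + t <= e^t by it reverses the
     inequality: U(x0, y0) is at most (1 + s C |x0|) times the displaced value. Dividing by s gives
     the sign of the quotient in [cS]. *)
  have := le_trans H (ler_wnM2r (ltW Us) (expR_ge1Dx _)).
  rewrite -(pmulr_rge0 _ s0) mulrDr mulVKf ?lt0r_neq0 //; lra.
have := dunkl_cherednik_le (h := T (Cinfty_shift y0 f)) k0 Urefl.
have := dotv_le_enorm (rho Pp k) x0.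
rewrite /D -/(U f x0 y0).
have := enorm_gt0 x00.
rewrite /C.
move: (complex.Re _) ('D_x0 _ _) (enorm _) (enorm _) (dotv _ _) U0.
move: (U f x0 y0) => u A B r e d u0 e0 h1 h2 h3.
(* The factor is C |x0| - <rho,x0>; its product with U(x0, y0) bounds from above the limit just
   shown to be nonnegative. *)
have : (r * e - d + e) * u < 0 by rewrite pmulr_rlt0 //; lra.
lra.
Unshelve. all: by end_near. Qed.

End Flow.

End Positivity.

Theorem corollary3p3 (R : realType) (n : nat)
    (Phi Pp : {fset 'rV[R]_n}) (k : 'rV[R]_n -> R)
    (Vk : Cinfty R n -> Cinfty R n) :
  root_system Phi -> irreducible_system Phi -> positive_system Phi Pp ->
  multiplicity Phi k -> (forall a, a \in Phi -> 0 <= k a) ->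
  trig_dunkl_intertwiner Pp k Vk ->
  forall f : Cinfty R n,
    (forall x, 0 <= f x :> R[i]) -> forall x, 0 <= Vk f x :> R[i].
Proof.
move=> _ _ [h [_ ->]] _ k0 TI f f0 x; have [lT _ _ _] := TI.
have k0' a : a \in [fset a in Phi | 0 < dotv a h]%fset -> 0 <= k a.
  by rewrite !inE => /andP[/k0].
have {}f0 z : complex.Im (f z) = 0 /\ 0 <= complex.Re (f z).
  by have := f0 z; rewrite lecE /= => /andP[/eqP-> ->].
have Ts (c : R[i]) (g : Cinfty R n) : Vk (c *: g) = c *: Vk g.
  pose TL := GRing.isLinear.Build _ _ _ _ Vk lT.
  pose TT : {linear Cinfty R n -> Cinfty R n} := HB.pack Vk TL.
  by rewrite -[Vk]/(TT : Cinfty R n -> Cinfty R n) linearZ.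
(* Since f is real and nonnegative, c f has nonnegative real part when c does. Complex linearity
   carries this to the image: c = 1 gives the sign of the real part, and c = i and c = -i force the
   imaginary part to vanish. *)
have T_ge0 (c : R[i]) : 0 <= complex.Re c -> 0 <= complex.Re (c * Vk f x).
  move=> c0; have := intertwiner_Re_ge0 (f := c *: f) TI x k0'.
  rewrite Ts; apply => z; have [fi fr] := f0 z.
  rewrite /part -[cpart _ _]/(complex.Re (c * f z)).
  move: fi fr; case: (f z) => [a b] /= -> a0; case: c c0 => [c d] /= c0.
  by rewrite mulr0 subr0 mulr_ge0.
have := T_ge0 1 ler01; have := T_ge0 'i%C (lexx _); have := T_ge0 (- 'i%C).
rewrite lecE; case: (Vk f x) => [a b] /=.
rewrite oppr0 => /(_ (lexx _)) h1 h2 h3.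
by apply/andP; split; [apply/eqP|]; lra.
Qed.
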